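(* For each $n$ fix any ansatz Born distribution $q_n$, that is, any probability distribution on $\{0,1\}^n$. Let $|\phi\rangle$ be a Haar-random unit vector in $\mathbb C^{2^n}$ and let $p_\phi(s)=|\langle s|\phi\rangle|^2$, $s\in\{0,1\}^n$, be its computational-basis Born distribution. Then for any polynomially bounded range $R_n=\operatorname{poly}(n)$, $$\Pr_\phi\left[\Gamma^\star(p_\phi\mid q_n)\le R_n\right]\le 2^{-n}+\exp\left[-2^{n/2}/2\right]$$ for all sufficiently large $n$.
   Context: For probability distributions $p,q$ on $\{0,1\}^n$, the exact DNP (diagonal non-unitary post-processing) dynamic range is $$\Gamma^\star(p\mid q)=\inf_w\left\{\frac{\max_s w(s)}{\min_s w(s)}\ :\ w:\{0,1\}^n\to(0,\infty),\ \ p(s)=\frac{w(s)q(s)}{\sum_t w(t)q(t)}\ \text{for all } s\right\},$$ with the convention $\Gamma^\star(p\mid q)=+\infty$ if no such $w$ exists. $\{|s\rangle\}_{s\in\{0,1\}^n}$ is the computational (standard) orthonormal basis of $\mathbb C^{2^n}$. *)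

(* Defs.v *)
From HB Require Import structures.
From mathcomp Require Import all_boot all_order all_algebra.
From mathcomp Require Import complex.
From mathcomp Require Import all_classical all_reals all_analysis.

Set Implicit Arguments.
Unset Strict Implicit.
Unset Printing Implicit Defensive.

Import Order.TTheory GRing.Theory Num.Theory numFieldNormedType.Exports.

Local Open Scope classical_set_scope.
Local Open Scope ring_scope.
Local Open Scope sesquilinear_scope.

Notation bits n := (n.-tuple bool).

Section DynamicRange.
Variables (R : realType) (n : nat).
Implicit Types (p q w : bits n -> R).

Definition is_distr p : Prop := (forall s, 0 <= p s) /\ \sum_s p s = 1.

(* The seed of the iterated max and min is itself a value of w, so these are
   the maximum and the minimum of w over the (nonempty) set of bit strings. *)
Definition bmax w : R := \big[Num.max/w (nseq_tuple n false)]_s w s.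
Definition bmin w : R := \big[Num.min/w (nseq_tuple n false)]_s w s.

Definition dnp_weight p q w : Prop :=
  (forall s, 0 < w s) /\ (forall s, p s = w s * q s / \sum_t (w t * q t)).

(* ereal_inf set0 = +oo, which is the value required when no weight exists. *)
Definition Gamma_star p q : \bar R :=
  ereal_inf [set (bmax w / bmin w)%:E | w in dnp_weight p q].

End DynamicRange.

Section HaarStates.
Variables (R : realType) (n : nat).

Lemma card_bits : #|{: bits n}| = (2 ^ n)%N.
Proof. by rewrite card_tuple card_bool. Qed.

Definition bits_index (s : bits n) : 'I_(2 ^ n) :=
  cast_ord card_bits (enum_rank s).

Definition ket (s : bits n) : 'cV[R[i]]_(2 ^ n) := delta_mx (bits_index s) 0.

Definition born (phi : 'cV[R[i]]_(2 ^ n)) (s : bits n) : R :=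
  complex.Re (`|((ket s)^t* *m phi) 0 0| ^+ 2).

(* C^(2^n) with its Borel sigma-algebra. The topology of the numFieldType R[i]
   is carried by its alias R[i]^o, and column vectors have the product
   topology. *)
Definition state_space :=
  g_sigma_algebraType (@open 'cV[(R[i])^o]_(2 ^ n)).

Definition unit_sphere : set state_space :=
  [set phi : 'cV[R[i]]_(2 ^ n) | phi^t* *m phi = 1%:M].

(* The Haar measure on unit vectors is the unique Borel probability measure
   that is carried by the unit sphere and invariant under the unitary group. *)
Definition is_haar_state (mu : probability state_space R) : Prop :=
  mu unit_sphere = 1%E /\
  forall (U : 'M[R[i]]_(2 ^ n)) (A : set state_space),
    U \is unitarymx -> measurable A ->
    mu ((fun phi : 'cV[R[i]]_(2 ^ n) => U *m phi) @^-1` A) = mu A.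

End HaarStates.

Definition poly_bounded (R : realType) (r : nat -> R) : Prop :=
  exists P : {poly R}, \forall n \near \oo, r n <= P.[n%:R].

(* Main.v *)
Require Import Defs.
From mathcomp Require Import all_boot all_order all_algebra.
From mathcomp Require Import complex ring lra zify.
From mathcomp Require Import all_classical all_reals all_analysis.
From mathcomp Require Import measurable_realfun.

(* If Gamma*(p | q) <= r, then p(s) q(t) <= r p(t) q(s) for all s and t, and p
   and q have the same support.  Split the bit strings into 2^(n-1) pairs that
   differ in the first bit.  Inside a pair with q(s) >= q(t) > 0 this forces
   p(t) <= r p(s), and this inequality fails for at least one of K = poly(r)
   unitaries that act on the two coordinates s and t only, because these
   unitaries send some vector close to any given direction of C^2 to the t-axis.
   By invariance of the Haar measure and a union bound over the K unitaries,
   each pair costs a factor 1 - 1/K, independently of the other pairs, so the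
   probability is at most (1 - 1/K)^(2^(n-1)) <= exp(- 2^(n/2) / 2) once
   K <= 2^(n/2).  If q(s) = 0 for some s, then p(s) = 0 < p(t) for some t; this
   event has 2^n disjoint images under unitaries that mix s and t, hence
   probability at most 2^-n. *)

Set Implicit Arguments.
Unset Strict Implicit.
Unset Printing Implicit Defensive.
Import Order.TTheory GRing.Theory Num.Theory numFieldNormedType.Exports.
Local Open Scope classical_set_scope.
Local Open Scope ring_scope.
Local Open Scope sesquilinear_scope.

(** * Unitaries acting on two coordinates *)

Section Rotation.
Context {C : numClosedFieldType} {N : nat}.
Implicit Types (s t i : 'I_N) (a b : C).

(* The unitary that is 1/sqrt(|a|^2 + |b|^2) times [[a, b], [- b^*, a^*]] on the
   coordinates s and t, and the identity on the others. *)
Definition plane_rot s t a b : 'M[C]_N :=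
  let d := sqrtC (`|a| ^+ 2 + `|b| ^+ 2) in
  \matrix_(i, j)
    if i == s then a / d * (j == s)%:R + b / d * (j == t)%:R
    else if i == t then - b^* / d * (j == s)%:R + a^* / d * (j == t)%:R
    else (j == i)%:R.

Lemma sum_delta (F : 'I_N -> C) i : \sum_j (j == i)%:R * F j = F i.
Proof.
rewrite (bigD1 i)//= eqxx mul1r big1 ?addr0// => j /negPf ->.
by rewrite mul0r.
Qed.

Lemma sum_delta2 (F : 'I_N -> C) s t a b :
  \sum_j (a * (j == s)%:R + b * (j == t)%:R) * F j = a * F s + b * F t.
Proof.
rewrite -(sum_delta F s) -(sum_delta F t) !big_distrr -big_split/=.
by apply: eq_bigr => j _; ring.
Qed.

Lemma plane_rot_mul1 s t a b p (X : 'M[C]_(N, p)) k :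
  (plane_rot s t a b *m X) s k =
  (a * X s k + b * X t k) / sqrtC (`|a| ^+ 2 + `|b| ^+ 2).
Proof.
rewrite mxE; under eq_bigr do rewrite mxE eqxx.
by rewrite (sum_delta2 (X ^~ k)); ring.
Qed.

Lemma plane_rot_mul2 s t a b p (X : 'M[C]_(N, p)) k : s != t ->
  (plane_rot s t a b *m X) t k =
  (- b^* * X s k + a^* * X t k) / sqrtC (`|a| ^+ 2 + `|b| ^+ 2).
Proof.
move=> st; rewrite mxE.
under eq_bigr do rewrite mxE eq_sym (negPf st) eqxx.
by rewrite (sum_delta2 (X ^~ k)); ring.
Qed.

Lemma plane_rot_mul_id s t a b p (X : 'M[C]_(N, p)) i k : i != s -> i != t ->
  (plane_rot s t a b *m X) i k = X i k.
Proof.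
move=> /negPf is_ /negPf it; rewrite mxE.
under eq_bigr do rewrite mxE is_ it.
exact: (sum_delta (X ^~ k)).
Qed.

Lemma plane_rot_unitary s t a b : s != t -> (a != 0) || (b != 0) ->
  plane_rot s t a b \is unitarymx.
Proof.
move=> st ab0; apply/unitarymxP/matrixP => i k.
set d := sqrtC (`|a| ^+ 2 + `|b| ^+ 2).
have d2gt0 : 0 < `|a| ^+ 2 + `|b| ^+ 2.
  case/orP: ab0 => h.
    by rewrite ltr_pwDl ?exprn_gt0 ?normr_gt0 ?exprn_ge0.
  by rewrite ltr_wpDl ?exprn_gt0 ?normr_gt0 ?exprn_ge0.
(* Both diagonal entries of the product equal 1 by this equation, which [field] receives below. *)
have dd : d * d = a * a^* + b * b^* by rewrite -expr2 sqrtCK !normCK.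
have d0 : d != 0 by rewrite sqrtC_eq0 gt_eqF.
have dJ : d^* = d by apply/CrealP; rewrite ger0_real// sqrtC_ge0 ltW.
have ts : (t == s) = false by rewrite eq_sym (negPf st).
have cE j l : ((plane_rot s t a b) ^t*) j l =
    if l == s then a^* / d * (j == s)%:R + b^* / d * (j == t)%:R
    else if l == t then - b / d * (j == s)%:R + a / d * (j == t)%:R
    else (j == l)%:R.
  rewrite !mxE -/d; case: ifP => _; last case: ifP => _.
  - by rewrite rmorphD !rmorphM !rmorph_nat !fmorphV /= dJ.
  - by rewrite rmorphD !rmorphM !rmorph_nat !fmorphV !rmorphN /= dJ !conjCK.
  - by rewrite rmorph_nat.
have [->|nis] := eqVneq i s; last have [->|nit] := eqVneq i t.
- rewrite plane_rot_mul1 !cE -/d mxE !eqxx (negPf st) ts.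
  have [_|ks] := eqVneq k s; last have [kt|kt] := eqVneq k t.
  + by rewrite ?mulr1n ?mulr0n; field: dd.
  + by rewrite ?mulr1n ?mulr0n; field.
  + by rewrite ?mulr1n ?mulr0n; ring.
- rewrite plane_rot_mul2// !cE -/d mxE !eqxx (negPf st) ts.
  have [->|ks] := eqVneq k s; last have [_|kt] := eqVneq k t.
  + by rewrite ts ?mulr1n ?mulr0n; field.
  + by rewrite ?mulr1n ?mulr0n; field: dd.
  + by rewrite ?mulr1n ?mulr0n; ring.
- rewrite plane_rot_mul_id// cE mxE (negPf nis) (negPf nit).
  have [->|ks] := eqVneq k s; last have [->|//] := eqVneq k t.
  + by rewrite (negPf nis) ?mulr1n ?mulr0n; ring.
  + by rewrite (negPf nit) ?mulr1n ?mulr0n; ring.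
Qed.

End Rotation.

(** * Squared moduli and a finite grid of complex slopes *)

Section Modulus.
Context {R : realType}.
Implicit Types z x y : R[i].

(** The norm of [R[i]] takes values in [R[i]]; this real polynomial form of its square suits [ring]
    and [nra]. *)
Definition absq z : R := complex.Re z ^+ 2 + complex.Im z ^+ 2.

Lemma absqE z : absq z = complex.Re (`|z| ^+ 2).
Proof. by rewrite -add_Re2_Im2. Qed.

Lemma absq_ge0 z : 0 <= absq z.
Proof. by rewrite addr_ge0 ?sqr_ge0. Qed.

Lemma absq_eq0 z : (absq z == 0) = (z == 0).
Proof.
by case: z => a b; rewrite /absq /= paddr_eq0 ?sqr_ge0// !sqrf_eq0 eq_complex.
Qed.

Lemma absqM x y : absq (x * y) = absq x * absq y.
Proof. by case: x y => [a b] [c d]; rewrite /absq /=; ring. Qed.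

Lemma absqN z : absq (- z) = absq z.
Proof. by rewrite /absq !raddfN !sqrrN. Qed.

Lemma absq_gt0 z : (0 < absq z) = (z != 0).
Proof. by rewrite lt_neqAle absq_ge0 eq_sym absq_eq0 andbT. Qed.

(** Norm preservation for the rotation with (a, b) = (1, -z), before division by its normalizing
    factor. *)
Lemma absq_rot (z x y : R[i]) :
  absq (x - z * y) + absq (z^* * x + y) = (1 + absq z) * (absq x + absq y).
Proof. by case: x y z => [a b] [c d] [e f]; rewrite /absq /=; ring. Qed.

(** Mesh 1/M on the square [-1, 1]^2, which contains every quotient x/y with |x| <= |y|. *)
Definition grid (M : nat) (jk : 'I_(2 * M).+1 * 'I_(2 * M).+1) : R[i] :=
  Complex ((jk.1%:R - M%:R) / M%:R) ((jk.2%:R - M%:R) / M%:R).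

Lemma grid_near_real (M : nat) (x : R) : (0 < M)%N -> -1 <= x <= 1 ->
  exists j : 'I_(2 * M).+1, ((x - (j%:R - M%:R) / M%:R) * M%:R) ^+ 2 <= 1.
Proof.
move=> M0 /andP[x1 x2].
have MR : 0 < M%:R :> R by rewrite ltr0n.
have h0 : 0 <= M%:R * (x + 1) by rewrite mulr_ge0 ?ler0n //; lra.
have := truncn_itv h0; set j := Num.truncn _ => /andP[j1 j2].
(* The endpoint x = 1 gives j = 2M, hence 2M + 1 grid values per axis. *)
have jM : (j < (2 * M).+1)%N.
  rewrite ltnS -(ler_nat R) (le_trans j1)// natrM; nra.
exists (Ordinal jM); rewrite /= mulrBl divfK ?gt_eqF//.
rewrite -natr1 in j2; nra.
Qed.

(** Real and imaginary parts of x/y are each approximated within 1/M; adding the two squares gives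
    the factor 2. *)
Lemma grid_near (M : nat) x y : (0 < M)%N -> y != 0 -> absq x <= absq y ->
  exists jk : 'I_(2 * M).+1 * 'I_(2 * M).+1,
    absq (x - grid jk * y) * M%:R ^+ 2 <= 2 * absq y.
Proof.
move=> M0 y0 xy.
have MR : 0 < M%:R :> R by rewrite ltr0n.
pose w := x / y.
have wy : x = w * y by rewrite divfK.
have w1 : absq w <= 1.
  by move: xy; rewrite wy absqM ger_pMl// absq_gt0.
have [|j hj] := @grid_near_real _ (complex.Re w) M0.
  by move: w1; rewrite /absq; nra.
have [|k hk] := @grid_near_real M (complex.Im w) M0.
  by move: w1; rewrite /absq; nra.
exists (j, k); rewrite wy -mulrBl absqM mulrAC ler_wpM2r ?absq_ge0//.
case: w {wy w1} hj hk => a b /=; rewrite /absq /= => hj hk.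
by rewrite mulrDl -!exprMn; lra.
Qed.

(** For a grid point near x/y, the first rotated entry A is at most 2|y|^2/M^2 < |y|^2/(rho + 1). By
    [absq_rot] the two entries add up to at least |y|^2, so the second exceeds rho A. *)
Lemma rot_breaks_ratio (M : nat) (rho : R) x y : (0 < M)%N -> 0 <= rho ->
  2 * (rho + 1) < M%:R ^+ 2 -> y != 0 -> absq x <= absq y ->
  exists jk : 'I_(2 * M).+1 * 'I_(2 * M).+1,
    rho * absq (x - grid jk * y) < absq ((grid jk)^* * x + y).
Proof.
move=> M0 r0 rM y0 xy; have [jk h] := grid_near M0 y0 xy; exists jk.
have := absq_rot (grid jk) x y.
move: h; set A := absq (x - _); set B := absq (_ + y) => h e.
have yp : 0 < absq y by rewrite absq_gt0.
have := absq_ge0 (grid jk); have := absq_ge0 x.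
have : 0 <= A by exact: absq_ge0.
have : 0 < M%:R ^+ 2 :> R by rewrite exprn_gt0// ltr0n.
move: (absq x) (absq y) (absq (grid _)) (M%:R ^+ 2) xy yp h e rM => X Y Z m.
move=> xy yp h e rM m0 A0 X0 Z0.
have : A < Y / (rho + 1).
  rewrite ltr_pdivlMr; last lra.
  by rewrite -(ltr_pM2r m0); nra.
rewrite ltr_pdivlMr; last lra.
nra.
Qed.

End Modulus.

(** * Borel measurability on the state space *)

Section Measurability.
Context {R : realType}.

Lemma ler_Re_norm (z : R[i]) : (`|complex.Re z|%:C)%C <= `|z|.
Proof. by rewrite normc_def lecR -sqrtr_sqr ler_wsqrtr// lerDl sqr_ge0. Qed.

Lemma ler_Im_norm (z : R[i]) : (`|complex.Im z|%:C)%C <= `|z|.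
Proof. by rewrite normc_def lecR -sqrtr_sqr ler_wsqrtr// lerDr sqr_ge0. Qed.

(** Additivity turns the bound into a 1-Lipschitz estimate; it serves for real and imaginary
    parts. *)
Lemma continuous_dominated (f : {additive R[i] -> R}) :
  (forall z, (`|f z|%:C)%C <= `|z|) -> continuous (f : R[i]^o -> R).
Proof.
move=> fle x; apply: (@cvgrPdist_lt _ _ _ _ (nbhs_filter (x : R[i]^o)) _ _).2.
move=> e e0.
have e0' : 0 < (e%:C)%C :> R[i] by rewrite ltcR.
have : nbhs (x : R[i]^o) (ball (x : R[i]^o) (e%:C)%C) by exact: nbhsx_ballx.
apply: (@filterS _ (nbhs (x : R[i]^o)) (nbhs_filter (x : R[i]^o))) => y.
rewrite /ball/= => xy.
by rewrite -raddfB -ltcR (le_lt_trans (fle _)).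
Qed.

(** A neighbourhood of a matrix contains a box of entrywise neighbourhoods, and there are finitely
    many entries. *)
Lemma continuous_mx (T : topologicalType) (U : topologicalType) m p
    (f : T -> 'M[U]_(m, p)) :
  (forall i j, continuous (fun x => f x i j)) -> continuous f.
Proof.
move=> fc x A [P Px PA].
rewrite nbhs_simpl/=.
have : \forall y \near x, forall i j, P i j (f y i j).
  by apply: filter_forall => i; apply: filter_forall => j; apply: fc; exact: Px.
by apply: filterS => y; exact: PA.
Qed.

Lemma continuous_mulmx m p (U : 'M[R[i]]_(m, p)) :
  continuous (mulmx U : 'cV[R[i]^o]_p -> 'cV[R[i]^o]_m).
Proof.
apply: continuous_mx => i j.
have -> : (fun x : 'cV[R[i]^o]_p => (U *m x) i j) =
    fun x => \sum_k ((U i k : R[i]^o) * x k j : R[i]^o).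
  by apply/funext => x; rewrite mxE.
apply: (continuous_big (@add_continuous R[i]^o)) => k _ x.
apply: cvgMl_tmp.
  exact: (nbhs_filter (x : 'cV[R[i]^o]_p)).
exact: (@coord_continuous R[i] _ _ k j x).
Qed.

Context {n : nat}.
Local Notation T := (state_space R n).

Lemma measurable_fun_dominated (f : {additive R[i] -> R}) (i : 'I_(2 ^ n)) :
  (forall z, (`|f z|%:C)%C <= `|z|) ->
  measurable_fun setT (fun phi : T => f ((phi : 'cV[R[i]]_(2 ^ n)) i 0)).
Proof.
move=> /continuous_dominated fc.
apply: (@measurability _ _ _ _ _ _ (@RGenOpens.G R)).
  exact: RGenOpens.measurableE.
move=> _ [_ [a [b ->]] <-].
rewrite setTI; apply: sub_sigma_algebra.
have /continuousP := fun x : 'cV[R[i]^o]_(2 ^ n) =>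
  continuous_comp (@coord_continuous R[i] _ _ i 0 x) (@fc _).
by apply; exact: itv_open.
Qed.

Lemma measurable_fun_absq (i : 'I_(2 ^ n)) :
  measurable_fun setT (fun phi : T => absq ((phi : 'cV[R[i]]_(2 ^ n)) i 0)).
Proof.
apply: measurable_funD; apply: measurable_funX.
  exact: (measurable_fun_dominated i ler_Re_norm).
exact: (measurable_fun_dominated i ler_Im_norm).
Qed.

Lemma measurable_mulmx (U : 'M[R[i]]_(2 ^ n)) :
  measurable_fun setT
    ((mulmx U : 'cV[R[i]]_(2 ^ n) -> 'cV[R[i]]_(2 ^ n)) : T -> T).
Proof.
apply: (@measurability _ _ T T setT _ (@open 'cV[(R[i])^o]_(2 ^ n))) => //.
move=> _ [A oA <-]; rewrite setTI; apply: sub_sigma_algebra.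
by exact: (continuousP _).1 (@continuous_mulmx _ _ U) A oA.
Qed.

End Measurability.

(** * Two bounds from measure-preserving maps *)

Section InvariantProbability.
Context d (T : measurableType d) (R : realType) (mu : probability T R).

Definition preserves (g : T -> T) : Prop :=
  measurable_fun setT g /\ forall A, measurable A -> mu (g @^-1` A) = mu A.

Lemma measurable_preimage (g : T -> T) (A : set T) :
  preserves g -> measurable A -> measurable (g @^-1` A).
Proof. by move=> [mg _] mA; rewrite -[_ @^-1` _]setTI; exact: mg. Qed.

Lemma fine_bigcup_le (I : finType) (F : I -> set T) (A : set T) :
  measurable A -> (forall i, measurable (F i)) ->
  (forall x, A x -> exists i, F i x) ->
  fine (mu A) <= \sum_i fine (mu (F i)).
Proof.
move=> mA mF AF.
have AU : A `<=` \big[setU/set0]_i F i.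
  by move=> x /AF[i Fix]; rewrite -bigcup_seq; exists i => //=; exact: mem_index_enum.
have mU : measurable (\big[setU/set0]_i F i).
  by apply: bigsetU_measurable => i _.
rewrite -lee_fin fineK ?fin_num_measure// -sumEFin.
under eq_bigr do rewrite fineK ?fin_num_measure//.
apply: le_trans (le_measure _ _ _ AU) _; rewrite ?inE//.
elim: (index_enum I) => [|i s IH]; first by rewrite !big_nil measure0.
rewrite !big_cons; apply: (le_trans (measureU2 _ _ _)) => //.
  by apply: bigsetU_measurable => j _.
by rewrite leeD2l.
Qed.

(* The sets A minus g_i^-1(W) cover A, and by invariance each of them has measure
   mu(A) - mu(A & W). *)
Lemma escape_contraction (I : finType) (g : I -> T -> T) (A W : set T) :
  (forall i, preserves (g i)) -> measurable A -> measurable W ->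
  (forall i, g i @^-1` A = A) ->
  (forall x, A x -> exists i, ~ W (g i x)) ->
  (0 < #|I|)%N ->
  fine (mu (A `&` W)) <= (1 - #|I|%:R^-1) * fine (mu A).
Proof.
move=> gP mA mW gA esc I0.
have mW' i : measurable (g i @^-1` W) by exact: measurable_preimage.
have mAW i : measurable (A `\` g i @^-1` W) by exact: measurableD.
have AF x : A x -> exists i, (A `\` g i @^-1` W) x.
  by move=> Ax; have [i Wi] := esc x Ax; exists i.
have := fine_bigcup_le mA mAW AF.
have E i : fine (mu (A `\` g i @^-1` W)) = fine (mu A) - fine (mu (A `&` W)).
  have -> : mu (A `&` W) = mu (A `&` g i @^-1` W).
    have [_ <-] := gP i; last exact: measurableI.
    by rewrite preimage_setI gA.
  rewrite measureD// ?ltey_eq ?fin_num_measure//.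
  by rewrite fineB ?fin_num_measure//; exact: measurableI.
under eq_bigr do rewrite E.
rewrite sumr_const -(mulr_natl (_ - _)) -[#|xpredT|]/#|I|.
have : 0 < #|I|%:R :> R by rewrite ltr0n.
move: (fine _) (fine _) (#|I|%:R) => a b K K0 h.
rewrite -(ler_pM2l K0) mulrA mulrBr mulr1 divff ?gt_eqF//; lra.
Qed.

(** The preimages of A are pairwise disjoint and all have measure mu(A), so N of them must fit into
    total mass 1. *)
Lemma disjoint_copies_le (g : nat -> T -> T) (A : set T) (N : nat) :
  (forall i, preserves (g i)) -> measurable A ->
  (forall i j x, A (g i x) -> A (g j x) -> i = j) ->
  (0 < N)%N -> fine (mu A) <= N%:R^-1.
Proof.
move=> gP mA gA N0.
have mF i : measurable (g i @^-1` A) by exact: measurable_preimage.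
have tF : trivIset setT (fun i => g i @^-1` A).
  by move=> i j _ _ [x [Ai Aj]]; exact: gA Ai Aj.
have := measure_bigsetU mu mF tF N.
rewrite (eq_bigr (fun=> mu A)) => [|i _]; last exact: (gP i).2 _ mA.
have := @probability_le1 _ _ _ mu (\big[setU/set0]_(i < N) (g i @^-1` A)).
move=> /[swap] ->; rewrite -[mu A]fineK ?fin_num_measure//.
rewrite sumEFin lee_fin sumr_const card_ord => h.
rewrite -[_^-1]mul1r ler_pdivlMr ?ltr0n// mulr_natr h//.
by apply: bigsetU_measurable => i _.
Qed.

End InvariantProbability.

(** * Haar measure of events on coordinate pairs *)

Section HaarBounds.
Context {R : realType} {n : nat} (mu : probability (state_space R n) R).
Context (haar : is_haar_state mu).
Local Notation T := (state_space R n).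
Local Notation N := (2 ^ n)%N.

Definition weight (phi : T) (i : 'I_N) : R := absq ((phi : 'cV[R[i]]_N) i 0).

Lemma measurable_weight i : measurable_fun setT (weight^~ i).
Proof. exact: measurable_fun_absq. Qed.

Definition rotate s t (ab : R[i] * R[i]) (phi : T) : T :=
  plane_rot s t ab.1 ab.2 *m (phi : 'cV[R[i]]_N).

Lemma preserves_rotate s t ab : s != t -> (ab.1 != 0) || (ab.2 != 0) ->
  preserves mu (rotate s t ab).
Proof.
move=> st ab0; split; first exact: measurable_mulmx.
by move=> A mA; apply: haar.2 => //; exact: plane_rot_unitary.
Qed.

Lemma weight_rotate_id s t ab phi i : i != s -> i != t ->
  weight (rotate s t ab phi) i = weight phi i.
Proof. by move=> si ti; rewrite /weight plane_rot_mul_id. Qed.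

Definition rot_norm (ab : R[i] * R[i]) : R[i] :=
  sqrtC (`|ab.1| ^+ 2 + `|ab.2| ^+ 2).

Lemma rot_norm_gt0 ab : (ab.1 != 0) || (ab.2 != 0) ->
  0 < absq (rot_norm ab)^-1.
Proof.
move=> h; rewrite absq_gt0 invr_eq0 sqrtC_eq0 paddr_eq0 ?exprn_ge0//.
by rewrite !expf_eq0/= !normr_eq0 negb_and.
Qed.

Lemma weight_rotate1 s t ab phi :
  weight (rotate s t ab phi) s =
  absq (ab.1 * (phi : 'cV[R[i]]_N) s 0 + ab.2 * (phi : 'cV[R[i]]_N) t 0)
  * absq (rot_norm ab)^-1.
Proof. by rewrite -absqM /weight plane_rot_mul1. Qed.

Lemma weight_rotate2 s t ab phi : s != t ->
  weight (rotate s t ab phi) t =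
  absq (- ab.2^* * (phi : 'cV[R[i]]_N) s 0 + ab.1^* * (phi : 'cV[R[i]]_N) t 0)
  * absq (rot_norm ab)^-1.
Proof. by move=> st; rewrite -absqM /weight plane_rot_mul2. Qed.

Lemma measurable_zero_pos s t :
  measurable [set phi : T | weight phi s = 0 /\ 0 < weight phi t].
Proof.
have -> : [set phi : T | weight phi s = 0 /\ 0 < weight phi t] =
   (weight^~ s @^-1` [set 0]) `&` (weight^~ t @^-1` `]0, +oo[%classic).
  by apply/seteqP; split => phi /=; rewrite in_itv/= andbT.
by apply: measurableI; rewrite -[_ @^-1` _]setTI; apply: measurable_weight.
Qed.

Lemma haar_zero_coord s t : s != t ->
  fine (mu [set phi : T | weight phi s = 0 /\ 0 < weight phi t]) <= 2 ^- n.
Proof.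
move=> st.
rewrite -natrX.
(* With x and y the coordinates at s and t, the k-th rotation maps s to a multiple of x - k y, so
   its preimage of the event lies on the line x = k y; distinct slopes meet only at y = 0. *)
pose ab (k : nat) : R[i] * R[i] := (1, - k%:R).
have ab0 k : ((ab k).1 != 0) || ((ab k).2 != 0) by rewrite oner_neq0.
apply: (disjoint_copies_le (g := fun k => rotate s t (ab k))).
- by move=> k; apply: preserves_rotate.
- exact: measurable_zero_pos.
- move=> i j phi [zi ti] [zj _].
  pose x := (phi : 'cV[R[i]]_N) s 0; pose y := (phi : 'cV[R[i]]_N) t 0.
  have xE k : weight (rotate s t (ab k) phi) s = 0 -> x = k%:R * y.
    rewrite weight_rotate1 => /eqP; rewrite mulf_eq0 (gt_eqF (rot_norm_gt0 (ab0 k))).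
    by rewrite orbF absq_eq0 mul1r mulNr subr_eq0 => /eqP.
  (* If y = 0 then x = 0 as well, and the rotated coordinate t would vanish too. *)
  have y0 : y != 0.
    apply/eqP => y0; have := xE i zi; rewrite y0 mulr0 => x0.
    move: ti; rewrite weight_rotate2// -/x -/y x0 y0 !mulr0 addr0.
    by rewrite (_ : absq 0 = 0) ?mul0r ?ltxx//; apply/eqP; rewrite absq_eq0.
  apply/eqP; rewrite -(eqr_nat R[i]); apply/eqP/(mulIf y0).
  by rewrite -(xE i zi) -(xE j zj).
- by rewrite expn_gt0.
Qed.

(** Strict positivity at s makes [rotate_escapes] hold even for vectors that vanish at both
    coordinates, so no null set has to be removed. *)
Definition ratio_bounded (rho : R) s t : set T :=
  [set phi | 0 < weight phi s /\ weight phi t <= rho * weight phi s].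

Lemma measurable_ratio_bounded rho s t : measurable (ratio_bounded rho s t).
Proof.
have -> : ratio_bounded rho s t = (weight^~ s @^-1` `]0, +oo[%classic) `&`
    (setT `&` [set phi | weight phi t <= rho * weight phi s]).
  by apply/seteqP; split => phi /=; rewrite in_itv/= andbT => -[? h]; split=> //; case: h.
apply: measurableI.
  by rewrite -[_ @^-1` _]setTI; apply: measurable_weight.
apply: measurable_fun_le => //; first exact: measurable_weight.
by apply: measurable_funM => //; exact: measurable_weight.
Qed.

Definition grid_index (M : nat) : finType :=
  (bool * ('I_(2 * M).+1 * 'I_(2 * M).+1))%type.

(* The second family is the first one with the two coordinates exchanged: it
   serves the vectors whose first coordinate is the larger one, since the grid
   only covers the unit square. *)
Definition grid_pair (M : nat) (c : grid_index M) : R[i] * R[i] :=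
  if c.1 then (1, - grid c.2) else (grid c.2, -1).

Lemma grid_pair_neq0 (M : nat) (c : grid_index M) :
  ((grid_pair c).1 != 0) || ((grid_pair c).2 != 0).
Proof.
by case: c => [[] jk]; rewrite /= ?oner_neq0// oppr_eq0 oner_neq0 orbT.
Qed.

Lemma rotate_escapes (M : nat) (rho : R) s t (phi : T) :
  s != t -> (0 < M)%N -> 0 <= rho -> 2 * (rho + 1) < M%:R ^+ 2 ->
  exists c : grid_index M, ~ ratio_bounded rho s t (rotate s t (grid_pair c) phi).
Proof.
move=> st M0 r0 rM.
(* Both rotated weights carry the same positive normalizing factor, so the comparison is made
   without it. *)
suff [c hc] : exists c : grid_index M,
  absq ((grid_pair c).1 * (phi : 'cV[R[i]]_N) s 0 +
        (grid_pair c).2 * (phi : 'cV[R[i]]_N) t 0) = 0 \/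
  rho * absq ((grid_pair c).1 * (phi : 'cV[R[i]]_N) s 0 +
        (grid_pair c).2 * (phi : 'cV[R[i]]_N) t 0) <
  absq (- (grid_pair c).2^* * (phi : 'cV[R[i]]_N) s 0 +
        (grid_pair c).1^* * (phi : 'cV[R[i]]_N) t 0).
  exists c; rewrite /ratio_bounded/= weight_rotate1 weight_rotate2//.
  have := rot_norm_gt0 (grid_pair_neq0 c); case: hc => [->|h] c0 [].
    by rewrite mul0r ltxx.
  by rewrite mulrA ler_pM2r// leNgt h.
set x := (phi : matrix _ _ _) s 0; set y := (phi : matrix _ _ _) t 0.
have [xy|/ltW yx] := leP (absq x) (absq y).
  have [y0|y0] := eqVneq y 0.
    move: xy; rewrite y0 => x0; exists (true, (ord0, ord0)); left => /=.
    have /eqP -> : x == 0.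
      by rewrite -absq_eq0 eq_le absq_ge0 andbT (le_trans x0)// le_eqVlt absq_eq0 eqxx.
    by rewrite !mulr0 addr0; apply/eqP; rewrite absq_eq0.
  have [jk h] := rot_breaks_ratio M0 r0 rM y0 xy.
  exists (true, jk); right => /=.
  by rewrite mul1r mulNr rmorphN opprK rmorph1 mul1r.
have [x0|x0] := eqVneq x 0.
  move: yx; rewrite x0 => y0; exists (true, (ord0, ord0)); left => /=.
  have /eqP -> : y == 0.
    by rewrite -absq_eq0 eq_le absq_ge0 andbT (le_trans y0)// le_eqVlt absq_eq0 eqxx.
  by rewrite !mulr0 addr0; apply/eqP; rewrite absq_eq0.
have [jk h] := rot_breaks_ratio M0 r0 rM x0 yx.
exists (false, jk); right => /=.
rewrite rmorphN opprK rmorph1 mul1r mulN1r addrC.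
have -> : - y + grid jk * x = - (y - grid jk * x) by rewrite opprB addrC.
by rewrite absqN (addrC x).
Qed.

(** Induction over a list of pairs: a rotation inside the new pair leaves the weights of the other
    pairs unchanged, as [c] is injective. The event for the earlier pairs is thus invariant, and
    [escape_contraction] gives one more factor. *)
Lemma haar_ratio_bounded (X : finType) (c : X * bool -> 'I_N) (M : nat) (rho : R) :
  injective c -> (0 < M)%N -> 0 <= rho -> 2 * (rho + 1) < M%:R ^+ 2 ->
  fine (mu [set phi | forall x, ratio_bounded rho (c (x, true)) (c (x, false)) phi])
  <= (1 - (#|grid_index M|)%:R^-1) ^+ #|X|.
Proof.
move=> cI M0 r0 rM.
pose E (xs : seq X) : set T := [set phi |
  forall x, x \in xs -> ratio_bounded rho (c (x, true)) (c (x, false)) phi].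
have E_cons x xs : E (x :: xs) = E xs `&` ratio_bounded rho (c (x, true)) (c (x, false)).
  apply/seteqP; split => phi.
    move=> h; split; first by move=> y yx; apply: h; rewrite inE yx orbT.
    by apply: h; rewrite mem_head.
  by move=> [h1 h2] y; rewrite inE => /orP[/eqP ->//|]; exact: h1.
have E0 : E [::] = setT by apply/seteqP; split.
have mE xs : measurable (E xs).
  elim: xs => [|x xs IH]; first by rewrite E0.
  by rewrite E_cons; apply: measurableI => //; exact: measurable_ratio_bounded.
have st x : c (x, true) != c (x, false) by rewrite (inj_eq cI) xpair_eqE andbF.
have I0 : (0 < #|grid_index M|)%N by apply/card_gt0P; exists (true, (ord0, ord0)).
have k01 : 0 <= 1 - (#|grid_index M|)%:R^-1 :> R.
  by rewrite subr_ge0 invf_le1 ?ler1n ?ltr0n.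
have H xs : uniq xs -> fine (mu (E xs)) <= (1 - (#|grid_index M|)%:R^-1) ^+ size xs.
  elim: xs => [_|x xs IH /= /andP[xn /IH {}IH]].
    by rewrite E0 probability_setT.
  rewrite E_cons exprS; apply: le_trans (ler_wpM2l k01 IH).
  apply: (escape_contraction
    (g := fun i => rotate (c (x, true)) (c (x, false)) (grid_pair i))) => //.
  - by move=> i; apply: preserves_rotate => //; exact: grid_pair_neq0.
  - exact: measurable_ratio_bounded.
  - move=> i; have rE y b phi : y \in xs ->
        weight (rotate (c (x, true)) (c (x, false)) (grid_pair i) phi) (c (y, b)) =
        weight phi (c (y, b)).
      move=> yxs; have yx : y != x by apply: contraNneq xn => <-.
      by apply: weight_rotate_id; rewrite (inj_eq cI) xpair_eqE (negPf yx).
    apply/seteqP; split => phi /= h y yxs; have := h y yxs;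
      by rewrite /ratio_bounded/= !rE.
  - by move=> phi _; exact: rotate_escapes.
rewrite (_ : [set phi | _] = E (enum X)); first by rewrite [#|X|]cardE H ?enum_uniq.
by apply/seteqP; split => phi h x; [move=> _; exact: h|apply: h; rewrite mem_enum].
Qed.

Lemma card_grid_index M : #|grid_index M| = (2 * (2 * M).+1 ^ 2)%N.
Proof. by rewrite !card_prod card_bool !card_ord. Qed.

End HaarBounds.

(** * Dynamic range as pairwise inequalities *)

Section DynamicRangeTheory.
Context {R : realType} {n : nat}.
Implicit Types p q w : bits n -> R.

Lemma distr_pos q : is_distr q -> exists s, 0 < q s.
Proof.
move=> [q0 q1]; apply: contrapT => /forallNP h.
suff : \sum_s q s = 0 by rewrite q1 => /eqP; rewrite oner_eq0.
by apply: big1 => s _; apply/eqP; rewrite eq_le q0 andbT leNgt; apply/negP/h.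
Qed.

Lemma dnp_weight_normalizer_gt0 q w : is_distr q -> (forall s, 0 < w s) ->
  0 < \sum_t w t * q t.
Proof.
move=> dq w0; have [s qs] := distr_pos dq.
rewrite (bigD1 s)//= ltr_wpDr ?mulr_gt0//.
by apply: sumr_ge0 => t _; rewrite mulr_ge0 ?dq.1// ltW.
Qed.

Lemma bmin_gt0 w : (forall s, 0 < w s) -> 0 < bmin w.
Proof. by move=> w0; rewrite /bmin; apply/bigmin_gtP; split. Qed.

(** The normalizer cancels: p(s) q(t) / (p(t) q(s)) = w(s)/w(t). The cross-multiplied form allows
    zeros of p and q. *)
Lemma dnp_weight_ratio p q w s t : is_distr q -> dnp_weight p q w ->
  p s * q t <= bmax w / bmin w * (p t * q s).
Proof.
move=> dq [w0 pE]; have Z0 := dnp_weight_normalizer_gt0 dq w0.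
rewrite !pE; set Z := \sum_t _ in Z0 *.
have m0 := bmin_gt0 w0.
have ws : w s <= bmax w by exact: le_bigmax.
have wt : bmin w <= w t by exact: bigmin_le.
have h : w s <= bmax w / bmin w * w t.
  rewrite mulrAC ler_pdivlMr//; apply: ler_pM => //; exact: ltW.
have c0 : 0 <= q s * q t / Z by rewrite divr_ge0 ?mulr_ge0 ?dq.1 // ltW.
have := ler_wpM2r c0 h; set a := bmax w / _ => hh.
have -> : w s * q s / Z * q t = w s * (q s * q t / Z) by ring.
by have <- : a * w t * (q s * q t / Z) = a * (w t * q t / Z * q s) by ring.
Qed.

(* Unlike Gamma_star <= r itself, this is visibly a measurable condition on p. *)
Definition proportionate (r : R) p q : Prop :=
  [/\ \sum_s p s = 1,
      forall s, if q s == 0 then p s = 0 else 0 < p s &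
      forall s t, p s * q t <= r * (p t * q s)].

(** Forward, each ratio p(s) q(t) / (p(t) q(s)) is a lower bound for the range of every weight,
    hence for the infimum. Backward, p/q on the support of q extends to a weight of range at most
    r. *)
Lemma Gamma_star_le p q (r : R) : is_distr q ->
  (Gamma_star p q <= r%:E)%E <-> proportionate r p q.
Proof.
move=> dq; split=> [Gr|[p1 pq0 pqr]].
  have [w wP] : exists w, dnp_weight p q w.
    apply: contrapT => /forallNP now; move: Gr; rewrite /Gamma_star.
    rewrite (_ : [set _ | _ in _] = set0) ?ereal_inf0 ?leye_eq//.
    by apply/seteqP; split => // x [w /now].
  have [w0 pE] := wP; have Z0 := dnp_weight_normalizer_gt0 dq w0.
  split=> [|s|s t].
  - by under eq_bigr do rewrite pE; rewrite -mulr_suml divff ?gt_eqF.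
  - case: eqP => qs; rewrite pE; first by rewrite qs mulr0 mul0r.
    by rewrite divr_gt0// mulr_gt0// lt_neqAle dq.1 andbT eq_sym; apply/eqP.
  - rewrite leNgt; apply/negP => lt_pq.
    have B0 : 0 <= p t * q s.
      by rewrite mulr_ge0 ?dq.1// pE divr_ge0 ?mulr_ge0 ?dq.1// ltW.
    (* Were it zero, the inequality of the weight [w] would already force p(s) q(t) <= 0. *)
    have Bgt0 : 0 < p t * q s.
      rewrite lt_neqAle B0 andbT; apply/eqP => BE.
      have := dnp_weight_ratio s t dq wP.
      by rewrite leNgt -BE mulr0; move: lt_pq; rewrite -BE mulr0 => ->.
    have : ((p s * q t / (p t * q s))%:E <= Gamma_star p q)%E.
      apply: le_ereal_inf_tmp => _ [v vP <-]; rewrite lee_fin ler_pdivrMr//.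
      exact: dnp_weight_ratio.
    by move=> /le_trans /(_ Gr); rewrite lee_fin ler_pdivrMr// leNgt lt_pq.
have [s0 qs0] := distr_pos dq.
have p0 s : 0 <= p s by have := pq0 s; case: ifP => _; [move=> ->|exact: ltW].
(* Off the support of q, w must be positive but must not enlarge the range. *)
pose w s := if q s == 0 then p s0 / q s0 else p s / q s.
have wE s : exists2 t, q t != 0 & w s = p t / q t.
  by rewrite /w; case: eqVneq => h; [exists s0; rewrite ?gt_eqF|exists s].
have w0 s : 0 < w s.
  have [t qt ->] := wE s; have := pq0 t; rewrite (negPf qt) => pt.
  by rewrite divr_gt0// lt_neqAle dq.1 andbT eq_sym.
have wr s t : w s <= r * w t.
  have [s' qs ->] := wE s; have [t' qt ->] := wE t.
  have qsp : 0 < q s' by rewrite lt_neqAle dq.1 andbT eq_sym.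
  have qtp : 0 < q t' by rewrite lt_neqAle dq.1 andbT eq_sym.
  by rewrite ler_pdivrMr// mulrA mulrAC ler_pdivlMr// -mulrA pqr.
have r0 : 0 < r by rewrite -(pmulr_lgt0 _ (w0 s0)) (lt_le_trans (w0 s0)).
apply: (@le_trans _ _ (bmax w / bmin w)%:E); last first.
  rewrite lee_fin ler_pdivrMr ?bmin_gt0// -ler_pdivrMl// /bmin.
  apply/bigmin_geP; split => [|s _]; rewrite ler_pdivrMl//;
    by apply/bigmax_leP; split.
apply: ereal_inf_lbound; exists w => //; split => // s.
have wq t : w t * q t = p t.
  rewrite /w; have := pq0 t; case: eqVneq => [->|qt _]; first by rewrite mulr0.
  by rewrite divfK.
by under eq_bigr do rewrite wq; rewrite p1 divr1 wq.
Qed.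

End DynamicRangeTheory.

(** * Polynomial against exponential growth *)

Lemma leq_pow_exp2 (C d n : nat) :
  (C * (8 * d.+1) ^ d.+1 < n -> C * n ^ d < 2 ^ (n %/ 8))%N.
Proof.
set c := ((8 * d.+1) ^ d.+1)%N => Cn.
have c0 : (0 < c)%N by rewrite expn_gt0.
(* From n < 8(d+1) 2^l follows n^(d+1) < c 2^(n/8). The extra power of n absorbs the constant C c,
   which is below n. *)
pose l := (n %/ (8 * d.+1))%N.
have nl : (n < 8 * d.+1 * 2 ^ l)%N.
  apply: (@leq_trans (8 * d.+1 * l.+1)); first by rewrite mulnC ltn_ceil.
  by rewrite leq_mul2l ltn_expl ?orbT.
have ld : (l * d.+1 <= n %/ 8)%N.
  by rewrite /l divnMA leq_divM.
rewrite -(ltn_pmul2r c0).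
have h : (n ^ d.+1 < c * 2 ^ (n %/ 8))%N.
  apply: (@leq_trans ((8 * d.+1 * 2 ^ l) ^ d.+1)); first by rewrite ltn_exp2r.
  by rewrite expnMn -expnM leq_mul2l leq_exp2l// ld orbT.
apply: (@leq_ltn_trans (n ^ d.+1)); last by rewrite mulnC.
by rewrite expnS mulnAC leq_mul2r (ltnW Cn) orbT.
Qed.

Lemma horner_nat_bound (R : realType) (P : {poly R}) :
  exists C d : nat, forall n : nat, (0 < n)%N -> `|P.[n%:R]| <= (C * n ^ d)%:R.
Proof.
elim/poly_ind: P => [|P c [C [d IH]]].
  by exists 0%N, 0%N => n _; rewrite horner0 normr0.
have [C' C'P] : exists C' : nat, `|c| <= C'%:R.
  by exists (Num.truncn `|c|).+1; rewrite ltW// truncnS_gt.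
exists (C + C')%N, d.+1 => n n0; rewrite !hornerE.
apply: le_trans (ler_normD _ _) _; rewrite normrM normr_nat mulnDl natrD.
apply: lerD; first by rewrite expnSr mulnA natrM ler_wpM2r ?IH.
apply: le_trans C'P _; rewrite ler_nat leq_pmulr// expn_gt0 n0//.
Qed.

(** * Measurability of the bounded-range event *)

Section BornRange.
Context {R : realType} {n : nat}.
Local Notation T := (state_space R n).

Lemma bits_index_inj : injective (@bits_index n).
Proof. by move=> s t /cast_ord_inj/enum_rank_inj. Qed.

Lemma bornE (phi : T) s : born phi s = weight phi (bits_index s).
Proof.
rewrite /weight absqE /born; congr (complex.Re (`|_| ^+ 2)).
rewrite mxE (bigD1 (bits_index s))//= !mxE !eqxx rmorph1 mul1r big1 ?addr0// => i.
by move=> /negPf si; rewrite !mxE si/= rmorph0 mul0r.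
Qed.

Lemma measurable_forall (I : finType) (P : I -> T -> Prop) :
  (forall i, measurable [set phi | P i phi]) ->
  measurable [set phi | forall i, P i phi].
Proof.
move=> mP; rewrite (_ : [set _ | _] = \bigcap_(i in setT) [set phi | P i phi]).
  by apply: fin_bigcap_measurable => [|i _]; [exact: finite_finset|exact: mP].
by apply/seteqP; split => phi /= h i; [move=> _|]; apply: h.
Qed.

Lemma measurable_Gamma_star_le (q : bits n -> R) (r : R) : is_distr q ->
  measurable [set phi : T | (Gamma_star (born phi) q <= r%:E)%E].
Proof.
move=> dq; have mb s : measurable_fun setT (fun phi : T => born phi s).
  by rewrite (_ : (fun _ => _) = weight^~ (bits_index s));
    [exact: measurable_weight|apply/funext => phi; exact: bornE].
rewrite (_ : [set _ | _] = [set phi : T | \sum_s born phi s = 1] `&`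
   ([set phi : T | forall s, if q s == 0 then born phi s = 0 else 0 < born phi s] `&`
    [set phi : T | forall s t, born phi s * q t <= r * (born phi t * q s)])); last first.
  apply/seteqP; split => phi /=; first by move=> /(Gamma_star_le _ _ dq)[].
  by move=> [? []*]; apply/(Gamma_star_le _ _ dq).
apply: measurableI.
  rewrite (_ : [set _ | _] = (fun phi : T => \sum_s born phi s) @^-1` [set 1])//.
  by rewrite -[_ @^-1` _]setTI; apply: measurable_sum.
apply: measurableI.
  apply: measurable_forall => s; case: (q s == 0).
    rewrite (_ : [set _ | _] = (fun phi : T => born phi s) @^-1` [set 0])//.
    by rewrite -[_ @^-1` _]setTI; apply: mb.
  rewrite (_ : [set _ | _] = (fun phi : T => born phi s) @^-1` `]0, +oo[%classic).
    by rewrite -[_ @^-1` _]setTI; apply: mb.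
  by apply/seteqP; split => phi /=; rewrite in_itv/= andbT.
apply: measurable_forall => s; apply: measurable_forall => t.
rewrite -[X in measurable X]setTI; apply: measurable_fun_le => //.
  exact: measurable_funM.
by apply: measurable_funM => //; exact: measurable_funM.
Qed.

End BornRange.

(** * Haar probability of a bounded range *)

Section HaarGamma.
Context {R : realType}.

Lemma haar_Gamma_star_le_zero (n : nat) (mu : probability (state_space R n) R)
    (q : bits n -> R) (r : R) : is_haar_state mu -> is_distr q ->
  (exists s, q s = 0) ->
  fine (mu [set phi : state_space R n | (Gamma_star (born phi) q <= r%:E)%E]) <= 2 ^- n.
Proof.
move=> haar dq [s qs]; have [t qt] := distr_pos dq.
have st : bits_index s != bits_index t.
  by rewrite (inj_eq bits_index_inj); apply: contraTneq qt => <-; rewrite qs ltxx.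
apply: le_trans (haar_zero_coord haar st).
apply: fine_le; rewrite ?fin_num_measure//.
- exact: measurable_Gamma_star_le.
- exact: measurable_zero_pos.
apply: le_measure; rewrite ?inE.
- exact: measurable_Gamma_star_le.
- exact: measurable_zero_pos.
move=> phi /= /(Gamma_star_le _ _ dq)[_ h _]; rewrite -!bornE.
by have := h s; have := h t; rewrite qs eqxx gt_eqF.
Qed.

Lemma haar_Gamma_star_le_pos (n : nat) (mu : probability (state_space R n.+1) R)
    (q : bits n.+1 -> R) (r rho : R) (M : nat) : is_haar_state mu -> is_distr q ->
  (forall s, 0 < q s) -> r <= rho -> 0 <= rho ->
  (0 < M)%N -> 2 * (rho + 1) < M%:R ^+ 2 ->
  fine (mu [set phi : state_space R n.+1 | (Gamma_star (born phi) q <= r%:E)%E])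
  <= (1 - (2 * (2 * M).+1 ^ 2)%:R^-1) ^+ (2 ^ n).
Proof.
move=> haar dq q0 rrho rho0 M0 rM.
(* o x swaps the roles of the two strings so that the one marked true has the
   larger q. *)
pose o (x : bits n) := q (cons_tuple true x) < q (cons_tuple false x).
pose b (xb : bits n * bool) : bits n.+1 := cons_tuple (xb.2 (+) o xb.1) xb.1.
have b_inj : injective b.
  move=> [x i] [y j] /(congr1 val)/= [] /[swap] /val_inj -> h.
  by congr pair; apply: addIb h.
have qb x : q (b (x, false)) <= q (b (x, true)).
  rewrite /b /= /o; case: ltP => //; exact: ltW.
have cI : injective (fun xb => bits_index (b xb)).
  by move=> x y /bits_index_inj/b_inj.
have := haar_ratio_bounded haar cI M0 rho0 rM.
rewrite card_grid_index card_bits; apply: le_trans.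
have mW : measurable [set phi : state_space R n.+1 | forall x,
    ratio_bounded rho (bits_index (b (x, true))) (bits_index (b (x, false))) phi].
  by apply: measurable_forall => x; exact: measurable_ratio_bounded.
apply: fine_le; rewrite ?fin_num_measure//; first exact: measurable_Gamma_star_le.
apply: le_measure; rewrite ?inE//; first exact: measurable_Gamma_star_le.
move=> phi /= /(Gamma_star_le _ _ dq)[_ p0 pr] x.
rewrite /ratio_bounded /= -!bornE.
have pp s : 0 < born phi s by have := p0 s; rewrite gt_eqF.
split=> //; set s := b (x, true); set t := b (x, false).
(* The chain is p(t) q(s) <= r p(s) q(t) <= rho p(s) q(t) <= rho p(s) q(s), the last step since q(t)
   <= q(s). *)
rewrite -(ler_pM2r (q0 s)); apply: le_trans (pr t s) _.
rewrite -mulrA; apply: (@le_trans _ _ (rho * (born phi s * q t))).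
  by rewrite ler_wpM2r// mulr_ge0// ltW.
by rewrite ler_wpM2l// ler_wpM2l ?qb// ltW.
Qed.

Lemma one_sub_inv_pow_le (K m : nat) : (0 < K)%N ->
  (1 - K%:R^-1) ^+ m <= expR (- (m%:R / K%:R)) :> R.
Proof.
move=> K0; rewrite -mulrN expRM_natl lerXn2r ?expR_ge1Dx ?nnegrE ?expR_ge0//.
by rewrite subr_ge0 invf_le1 ?ler1n// ltr0n.
Qed.

Lemma powR_half (n : nat) (h := 2 `^ (n%:R / 2) : R) :
  h * h = 2 ^+ n /\ 2 ^+ n./2 <= h.
Proof.
split.
  rewrite -powRD; last by rewrite pnatr_eq0 implybT.
  by rewrite -splitr powR_mulrn ?ler0n.
rewrite -powR_mulrn ?ler0n// ler_powR ?ler1n//.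
by rewrite ler_pdivlMr// -natrM ler_nat muln2 -{2}(odd_double_half n) leq_addl.
Qed.

(** With h = 2^((n+1)/2), the number of pairs is 2^n = h^2/2, and K <= h gives 2^n/K >= h/2: this is
    the 1/2 in the final exponent. *)
Lemma pow_contraction_le (n K : nat) : (0 < K)%N -> (K <= 2 ^ (n.+1)./2)%N ->
  (1 - K%:R^-1) ^+ (2 ^ n) <= expR (- (2 `^ (n.+1%:R / 2) / 2)) :> R.
Proof.
move=> K0 K2; apply: le_trans (one_sub_inv_pow_le _ K0) _.
rewrite ler_expR lerN2; have [] := powR_half n.+1.
set h := 2 `^ _ => hh lh.
have Kh : K%:R <= h by apply: le_trans lh; rewrite -natrX ler_nat.
have K0' : 0 < K%:R :> R by rewrite ltr0n.
rewrite ler_pdivlMr// natrX; move: hh; rewrite exprS => hh.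
have : 0 <= h by rewrite powR_ge0.
nra.
Qed.

Lemma haar_Gamma_star_le (n : nat) (mu : probability (state_space R n) R)
    (q : bits n -> R) (r rho : R) : is_haar_state mu -> is_distr q ->
  (24 <= n)%N -> r <= rho -> 0 <= rho <= (2 ^ (n %/ 8))%:R ->
  fine (mu [set phi : state_space R n | (Gamma_star (born phi) q <= r%:E)%E])
  <= 2 ^- n + expR (- (2 `^ (n%:R / 2) / 2)).
Proof.
move=> haar dq n24 rrho /andP[rho0].
have M8 : (8 <= 2 ^ (n %/ 8))%N by rewrite (@leq_exp2l 2 3)// leq_divRL.
have [[s qs]|nq0] := pselect (exists s, q s = 0).
  move=> _; apply: le_trans (haar_Gamma_star_le_zero r haar dq _) _.
    by exists s.
  by rewrite lerDl expR_ge0.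
have qpos s : 0 < q s.
  by rewrite lt_neqAle dq.1 andbT; apply/eqP => h; apply: nq0; exists s.
case: n mu q haar dq n24 M8 nq0 qpos => // n mu q haar dq n24.
set M := (2 ^ _)%N => M8 _ qpos rhoM.
(* With M = 2^(n/8), rho <= M and M >= 8, one has 2(M + 1) < M^2. *)
have rM : 2 * (rho + 1) < M%:R ^+ 2.
  have : 8 <= M%:R :> R by rewrite ler_nat.
  by move: rhoM; move: (M%:R) => m; nra.
have M0 : (0 < M)%N by rewrite (leq_trans _ M8).
apply: le_trans (haar_Gamma_star_le_pos haar dq qpos rrho rho0 M0 rM) _.
apply: (@le_trans _ _ (expR (- (2 `^ (n.+1%:R / 2) / 2)))); last first.
  by rewrite lerDr invr_ge0 exprn_ge0// ler0n.
apply: pow_contraction_le; first by rewrite muln_gt0 expn_gt0.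
(* The number of rotations is 2(2M + 1)^2 <= 32 M^2, and the exponent 5 + 2 floor(n/8) is at most
   floor(n/2) from n = 24 on. *)
apply: (@leq_trans (2 ^ 5 * M ^ 2)).
  by move: M8; clear; nia.
by rewrite /M -expnM -expnD leq_exp2l//; lia.
Qed.

End HaarGamma.

Theorem theorem1 (R : realType)
    (q : forall n : nat, bits n -> R)
    (hq : forall n : nat, is_distr (q n))
    (haar : forall n : nat, probability (state_space R n) R)
    (hhaar : forall n : nat, is_haar_state (haar n))
    (r : nat -> R)
    (hr : poly_bounded r) :
  \forall n \near \oo,
    (haar n [set phi : state_space R n |
               (Gamma_star (born phi) (q n) <= (r n)%:E)%E]
     <= (2 ^- n + expR (- (2 `^ (n%:R / 2) / 2)))%:E)%E.
Proof.
have [P rP] := hr; have [C [d PC]] := horner_nat_bound P.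
near=> n.
have n24 : (24 <= n)%N by near: n; exact: nbhs_infty_ge.
have nC : (C * (8 * d.+1) ^ d.+1 < n)%N by near: n; exact: nbhs_infty_gt.
have rn : r n <= P.[n%:R] by near: n.
rewrite -[haar n _]fineK; last first.
  by apply: fin_num_measure; exact: measurable_Gamma_star_le.
(* The absolute value gives a nonnegative majorant of [r n], which itself may be negative. *)
rewrite lee_fin; apply: (haar_Gamma_star_le (rho := `|P.[n%:R]|)) => //.
  exact: le_trans rn (ler_norm _).
rewrite normr_ge0/= (le_trans (PC n _))//; first by rewrite (leq_trans _ n24).
by rewrite ler_nat ltnW// leq_pow_exp2.
Unshelve. all: by end_near. Qed.
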